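(* Let $X=X_{\rm lin}+\sum_{n\in A(X)}D_n$ be a local analytic vector field on $\mathbb{C}^\nu$ with diagonal linear part $X_{\rm lin}=\sum_{i=1}^\nu\lambda_ix_i\partial_{x_i}$, containing no small divisors, and whose spectrum $\underline{\lambda}=(\lambda_1,\dots,\lambda_\nu)$ lies in the Poincaré domain. Then the formal linearizing automorphism $$Na=\sum_{\underline{s}\in A^*(X)}Na^{\underline{s}}D_{\underline{s}},\qquad Na^\emptyset=1,\quad Na^{(s_1,\dots,s_r)}=\frac{1}{\omega_1(\omega_1+\omega_2)\cdots(\omega_1+\dots+\omega_r)},\quad \omega_i=s_i\cdot\underline{\lambda},$$ is analytic.
   Context: $X=\sum X_i(x)\partial_{x_i}$ with $X_i\in\mathbb{C}\{x\}$, $X_i(0)=0$. $X-X_{\rm lin}=\sum_{n\in A(X)}D_n$, where each $D_n$ is a non-zero derivation homogeneous of degree $n=(n_1,\dots,n_\nu)$: $D_n(x^m)=c_{n,m}x^{n+m}$, $c_{n,m}\in\mathbb{C}$ (all $n_i\ge0$ except at most one equal to $-1$; $\sum n_i\ge1$). $A(X)$ is the set of degrees occurring, $A^*(X)$ the set of finite sequences of elements of $A(X)$, $n\cdot\underline{\lambda}=\sum n_i\lambda_i$, and $D_{\underline{s}}=D_{s_1}\cdots D_{s_r}$ for $\underline{s}=(s_1,\dots,s_r)$, $D_\emptyset=\mathrm{Id}$. The Poincaré domain is the set of $\underline{\lambda}$ such that the convex hull of $\{\lambda_1,\dots,\lambda_\nu\}$ in $\mathbb{C}$ does not contain $0$.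 $X$ contains no small divisors if there is $C>0$ with $|\omega|\ge C$ for all $\omega\in\Omega$, where $\Omega$ is the set of values $(s_1+\dots+s_r)\cdot\underline{\lambda}$, for all non-empty $(s_1,\dots,s_r)\in A^*(X)$; in particular $X$ is non-resonant and $Na$ is a well-defined formal automorphism of $\mathbb{C}[[x]]$ with $Na\,X\,Na^{-1}=X_{\rm lin}$. That $Na$ is analytic means that the associated change of variables $h=(Na(x_1),\dots,Na(x_\nu))$ is analytic at $0$ (i.e. $Na(x_i)\in\mathbb{C}\{x\}$). *)

(* Defs.v *)
From HB Require Import structures.
From mathcomp Require Import all_boot all_order all_algebra.
From mathcomp Require Import complex.
From mathcomp Require Import all_classical all_reals all_analysis.
From mathcomp Require Import zify.

Set Implicit Arguments.
Unset Strict Implicit.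
Unset Printing Implicit Defensive.

Import Order.TTheory GRing.Theory Num.Theory.
Local Open Scope classical_set_scope.
Local Open Scope ring_scope.
Local Open Scope complex_scope.

(* C is [R[i]], for an arbitrary [R : realType]. *)

Definition cmod (R : realType) (z : R[i]) : R := complex.Re `|z|.

(* Exponents of monomials, and degrees of homogeneous operators: the latter
   may have negative entries. *)
Definition mindex (nu : nat) := {ffun 'I_nu -> nat}.
Definition degree (nu : nat) := {ffun 'I_nu -> int}.

Definition mindex_add nu (m n : mindex nu) : mindex nu :=
  [ffun i => (m i + n i)%N].
Definition mindex1 nu (i : 'I_nu) : mindex nu := [ffun j => nat_of_bool (j == i)].
Definition mindex_size nu (m : mindex nu) : nat := (\sum_i m i)%N.

(* C[[x_1, ..., x_nu]]: [f m] is the coefficient of x^m. *)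
Definition fps (R : realType) (nu : nat) := mindex nu -> R[i].

Definition fps_var (R : realType) nu (i : 'I_nu) : fps R nu :=
  fun m => (m == mindex1 i)%:R.

(* A finite sum, by [finite_fps_mul]. *)
Definition fps_mul (R : realType) nu (f g : fps R nu) : fps R nu := fun k =>
  \sum_(p \in [set p : mindex nu * mindex nu | mindex_add p.1 p.2 = k])
    f p.1 * g p.2.

Definition fps_deriv (R : realType) nu (i : 'I_nu) (f : fps R nu) : fps R nu :=
  fun m => (m i).+1%:R * f (mindex_add m (mindex1 i)).

(* C{x}: absolute convergence at every point of some polydisc around 0. *)
Definition fps_analytic (R : realType) nu (f : fps R nu) : Prop :=
  exists2 r : R, 0 < r &
    forall z : 'I_nu -> R[i], (forall i, cmod (z i) < r) ->
      (\esum_(m in [set: mindex nu])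
         (cmod (f m * \prod_i z i ^+ m i))%:E < +oo)%E.

(* A formal vector field sum_i X_i(x) d/dx_i, given by its components, and its
   action as a derivation of C[[x]]. *)
Definition vfield (R : realType) (nu : nat) := 'I_nu -> fps R nu.

Definition vf_act (R : realType) nu (X : vfield R nu) (f : fps R nu) :
    fps R nu :=
  fun k => \sum_i fps_mul (X i) (fps_deriv i f) k.

Definition vf_sub (R : realType) nu (X Y : vfield R nu) : vfield R nu :=
  fun i m => X i m - Y i m.

(* Local analytic vector fields: X_i in C{x} and X_i(0) = 0. *)
Definition local_analytic (R : realType) nu (X : vfield R nu) : Prop :=
  forall i, fps_analytic (X i) /\ X i [ffun=> 0%N] = 0.

Definition vf_lin (R : realType) nu (X : vfield R nu) : vfield R nu :=
  fun i m => if mindex_size m == 1%N then X i m else 0.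

Definition diag_vf (R : realType) nu (lam : 'I_nu -> R[i]) : vfield R nu :=
  fun i m => lam i * fps_var R i m.

(* The part of Y that is homogeneous of degree n: in the i-th component only
   the monomial x^n x_i is kept (none if n + e_i has a negative entry). *)
Definition vf_homog (R : realType) nu (Y : vfield R nu) (n : degree nu) :
    vfield R nu :=
  fun i m => if [forall j, (m j)%:Z == n j + (j == i)%:Z] then Y i m else 0.

(* D_n, characterized by [hcompE] and [vf_act_hcomp]. *)
Definition hcomp (R : realType) nu (X : vfield R nu) (n : degree nu) :
    fps R nu -> fps R nu :=
  vf_act (vf_homog (vf_sub X (vf_lin X)) n).

Definition degrees (R : realType) nu (X : vfield R nu) : set (degree nu) :=
  [set n | hcomp X n <> (fun _ _ => 0)].

(* A^*(X), and D_s for s = (s_1, ..., s_r). *)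
Definition words (R : realType) nu (X : vfield R nu) : set (seq (degree nu)) :=
  [set s : seq (degree nu) | forall n, n \in s -> degrees X n].

Definition hcomp_word (R : realType) nu (X : vfield R nu)
    (s : seq (degree nu)) (f : fps R nu) : fps R nu :=
  foldr (hcomp X) f s.

Definition pairing (R : realType) nu (n : degree nu) (lam : 'I_nu -> R[i]) :
    R[i] :=
  \sum_i (n i)%:~R * lam i.

Definition Omega (R : realType) nu (X : vfield R nu) (lam : 'I_nu -> R[i]) :
    set R[i] :=
  [set w | exists s : seq (degree nu),
     [/\ words X s, s <> [::] & w = pairing (\sum_(n <- s) n) lam]].

Definition no_small_divisors (R : realType) nu (X : vfield R nu)
    (lam : 'I_nu -> R[i]) : Prop :=
  exists2 C : R, 0 < C & forall w, Omega X lam w -> C <= cmod w.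

Definition convex_hull (R : realType) nu (lam : 'I_nu -> R[i]) : set R[i] :=
  [set z | exists t : 'I_nu -> R,
     [/\ forall i, 0 <= t i, \sum_i t i = 1 & z = \sum_i (t i)%:C * lam i]].

Definition Poincare_domain (R : realType) nu : set ('I_nu -> R[i]) :=
  [set lam | ~ convex_hull lam 0].

(* [take k s] is (s_1, ..., s_k), so the k-th factor is omega_1 + ... + omega_k. *)
Definition Na_coef (R : realType) nu (lam : 'I_nu -> R[i])
    (s : seq (degree nu)) : R[i] :=
  (\prod_(1 <= k < (size s).+1) \sum_(n <- take k s) pairing n lam)^-1.

(* Each coefficient is a finite sum when X(0) = 0, by [Na_finite]. *)
Definition Na (R : realType) nu (X : vfield R nu) (lam : 'I_nu -> R[i])
    (f : fps R nu) : fps R nu :=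
  fun k => \sum_(s \in words X) Na_coef lam s * hcomp_word X s f k.

(* Analyticity of the change of variables h = (Phi(x_1), ..., Phi(x_nu)). *)
Definition analytic_map (R : realType) nu
    (Phi : fps R nu -> fps R nu) : Prop :=
  forall i, fps_analytic (Phi (fps_var R i)).

Lemma finite_mindex_le nu (K : nat) :
  finite_set [set m : mindex nu | forall j, (m j <= K)%N].
Proof.
apply: (@sub_finite_set _ _
  ((fun f : {ffun 'I_nu -> 'I_K.+1} => [ffun j => nat_of_ord (f j)] : mindex nu)
     @` setT)); last by apply: finite_image; exact: finite_finset.
move=> m mK; exists [ffun j => inord (m j)] => //.
by apply/ffunP => j; rewrite !ffunE inordK // ltnS; exact: mK.
Qed.

Lemma finite_degree_le nu (K : nat) :
  finite_set [set n : degree nu | forall j, -1 <= n j <= K%:Z].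
Proof.
apply: (@sub_finite_set _ _
  ((fun m : mindex nu => [ffun j => (m j)%:Z - 1] : degree nu)
     @` [set m : mindex nu | forall j, (m j <= K.+1)%N])); last first.
  by apply: finite_image; exact: finite_mindex_le.
move=> n nK; exists [ffun j => absz (n j + 1)].
  by move=> j; rewrite ffunE; move: (nK j) => /andP[]; lia.
apply/ffunP => j; rewrite !ffunE; move: (nK j) => /andP[nj1 _].
by rewrite gez0_abs ?addrK //; lia.
Qed.

Lemma finite_seq_le (T : eqType) (B : set T) (K : nat) : finite_set B ->
  finite_set [set s : seq T | (size s <= K)%N /\ {in s, forall x, B x}].
Proof.
move=> finB; elim: K => [|K IH].
  by apply: (sub_finite_set _ (finite_set1 [::])) => -[|x s] [].
apply: (@sub_finite_set _ _ ([set [::]] `|` (fun p => p.1 :: p.2) @`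
  (B `*` [set s : seq T | (size s <= K)%N /\ {in s, forall x, B x}]))); last first.
  rewrite finite_setU; split; first exact: finite_set1.
  by apply: finite_image; exact: finite_setX.
move=> [|x s] [/= ss Bs]; first by left.
right; exists (x, s) => //; split; first exact/Bs/mem_head.
by split => // y ys; apply: Bs; rewrite inE ys orbT.
Qed.

Lemma finite_fps_mul nu (k : mindex nu) :
  finite_set [set p : mindex nu * mindex nu | mindex_add p.1 p.2 = k].
Proof.
pose K := (\sum_j k j)%N.
pose B := [set m : mindex nu | forall j, (m j <= K)%N].
apply: (@sub_finite_set _ _ (B `*` B)); last first.
  by apply: finite_setX; exact: finite_mindex_le.
move=> [p q] /= pqk; have kK j : (p j + q j <= K)%N.
  by rewrite /K -pqk (bigD1 j) //= !ffunE leq_addr.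
by split => j; apply: leq_trans (kK j); rewrite ?leq_addr ?leq_addl.
Qed.

Section hcomp_theory.
Variables (R : realType) (nu : nat).
Implicit Types (X Y : vfield R nu) (n : degree nu) (f : fps R nu).

Lemma vf_homogE Y n i m : vf_homog Y n i m != 0 ->
  (forall j, (m j)%:Z = n j + (j == i)%:Z) /\ Y i m != 0.
Proof.
rewrite /vf_homog; case: ifPn; last by rewrite eqxx.
by move=> /forallP nm Ym; split => // j; exact/eqP.
Qed.

(* D_n (x^m) = c_(n, m) x^(n + m). *)
Lemma hcompE X n : exists c : mindex nu -> R[i], forall f (k : mindex nu),
  (forall m : mindex nu, (forall j, (k j)%:Z = n j + (m j)%:Z) ->
     hcomp X n f k = c m * f m) /\
  ((forall m : mindex nu, ~ (forall j, (k j)%:Z = n j + (m j)%:Z)) -> hcomp X n f k = 0).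
Proof.
pose Z := vf_homog (vf_sub X (vf_lin X)) n.
pose a (i : 'I_nu) : mindex nu := [ffun j => absz (n j + (j == i)%:Z)].
exists (fun m => \sum_i (m i)%:R * Z i (a i)) => f k.
have Za i m : Z i m != 0 -> m = a i.
  move=> /vf_homogE[mE _]; apply/ffunP => j; rewrite ffunE.
  by rewrite -(mE j) absz_nat.
split => [m km|knm]; rewrite /hcomp /vf_act -/Z; last first.
  apply: big1 => i _; apply: fsbig1 => -[p q] /= pqk.
  have [->|Zp] := eqVneq (Z i p) 0; first by rewrite mul0r.
  have [pE _] := vf_homogE Zp; exfalso.
  apply: (knm (mindex_add q (mindex1 i))) => j; rewrite -pqk !ffunE.
  by have := pE j; case: (j == i) => /=; lia.
rewrite mulr_suml; apply: eq_bigr => i _.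
have [Zi0|Zi0] := eqVneq (Z i (a i)) 0.
  rewrite Zi0 mulr0 mul0r; apply: fsbig1 => -[p q] /= pqk.
  have [->|Zp] := eqVneq (Z i p) 0; first by rewrite mul0r.
  by move: (Zp); rewrite (Za _ _ Zp) Zi0 eqxx.
have [aE _] := vf_homogE Zi0.
have [mi0|mi0] := eqVneq (m i) 0%N.
  rewrite mi0 !mul0r; apply: fsbig1 => -[p q] /= pqk.
  have [->|Zp] := eqVneq (Z i p) 0; first by rewrite mul0r.
  exfalso; have := km i; have := aE i; rewrite -(Za _ _ Zp) -pqk ffunE eqxx mi0.
  by lia.
pose b : mindex nu := [ffun j => (m j - (j == i))%N].
have bm : mindex_add b (mindex1 i) = m.
  apply/ffunP => j; rewrite !ffunE.
  by have [->|ji] := eqVneq j i => /=; lia.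
have abk : mindex_add (a i) b = k.
  apply/ffunP => j; rewrite [LHS]ffunE; have := km j; have := aE j.
  rewrite [b j]ffunE; have [->|ji] := eqVneq j i => /=; lia.
rewrite /fps_mul -(fsbig_widen [set (a i, b)]); first last.
- move=> [p q] /= [pqk pq]; have [->|Zp] := eqVneq (Z i p) 0.
    by rewrite mul0r.
  exfalso; apply: pq; have pa := Za _ _ Zp; rewrite pa; congr pair.
  apply/ffunP => j; have /ffunP/(_ j) := pqk; have /ffunP/(_ j) := abk.
  by rewrite pa ![mindex_add _ _ j]ffunE => <- /addnI.
- by move=> _ ->.
rewrite fsbig_set1 /fps_deriv bm mulrA [Z _ _ * _]mulrC; congr (_%:R * _ * _).
by rewrite ffunE eqxx; lia.
Qed.

Lemma hcomp_neq0 X n f (k : mindex nu) : hcomp X n f k != 0 ->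
  exists2 m : mindex nu, (forall j, (k j)%:Z = n j + (m j)%:Z) & f m != 0.
Proof.
have [c cE] := hcompE X n; have [c1 c2] := cE f k => h0.
have [[m km]|] := pselect (exists m : mindex nu, forall j, (k j)%:Z = n j + (m j)%:Z).
  by exists m => //; move: h0; rewrite (c1 _ km) mulf_eq0 => /norP[].
by move=> /forallNP/c2 h00; rewrite h00 eqxx in h0.
Qed.

Lemma degreesP X n : (forall i, X i [ffun=> 0%N] = 0) -> degrees X n ->
  (exists i, forall j, - (j == i)%:Z <= n j) /\ 1 <= \sum_j n j.
Proof.
move=> X0 Xn; pose Z := vf_homog (vf_sub X (vf_lin X)) n.
have [[i [m Zm]]|Z0] := pselect (exists i m, Z i m != 0); last first.
  exfalso; apply: Xn; apply/funext => f; apply/funext => k.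
  apply: big1 => i _; apply: fsbig1 => -[p q] /= _.
  have [Zp|Zp] := eqVneq (Z i p) 0; first by rewrite -/Z Zp mul0r.
  by exfalso; apply: Z0; exists i, p.
have [mE] := vf_homogE Zm; rewrite /vf_sub /vf_lin.
case: ifPn; rewrite ?subrr ?eqxx // => m1 Xm.
split; first by exists i => j; have := mE j; lia.
have -> : \sum_j n j = (mindex_size m)%:Z - 1.
  have -> : (mindex_size m)%:Z = \sum_j ((m j)%:Z).
    by rewrite /mindex_size -natz natr_sum; apply: eq_bigr => j _; rewrite natz.
  under [in RHS]eq_bigr => j _ do rewrite mE.
  rewrite big_split /= -addrA -[LHS]addr0; congr (_ + _).
  rewrite (bigD1 i) //= eqxx big1 ?addr0 ?subrr // => j /negbTE ->.
  by [].
suff : mindex_size m != 0%N by move: m1; lia.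
apply: contra Xm => /eqP m0; rewrite subr0 (_ : m = [ffun=> 0%N]) ?X0 //.
apply/ffunP => j; rewrite ffunE; move: m0; rewrite /mindex_size (bigD1 j) //=.
by lia.
Qed.

Lemma hcomp_word_neq0 X s f (k : mindex nu) : hcomp_word X s f k != 0 ->
  exists2 m : mindex nu, (forall j, (k j)%:Z = \sum_(n <- s) n j + (m j)%:Z) & f m != 0.
Proof.
elim: s k => [|n s IH] k /=.
  by exists k => // j; rewrite big_nil add0r.
move=> /hcomp_neq0[k' kk' /IH[m k'm fm]]; exists m => // j.
by rewrite big_cons kk' k'm addrA.
Qed.

Lemma Na_finite X f k : (forall i, X i [ffun=> 0%N] = 0) ->
  finite_set [set s | words X s /\ hcomp_word X s f k != 0].
Proof.
move=> X0; pose K := mindex_size k.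
pose B := [set n : degree nu | forall j, -1 <= n j <= (K + nu)%:Z].
apply: (sub_finite_set _ (@finite_seq_le _ B K (@finite_degree_le _ _))).
move=> s [Xs /hcomp_word_neq0[m km _]].
have deg1 n : n \in s -> (forall j, -1 <= n j) /\ 1 <= \sum_j n j.
  move=> /Xs/(degreesP X0)[[i ni] n1]; split => // j.
  by have := ni j; lia.
have tot : \sum_(n <- s) \sum_j n j <= K%:Z.
  have -> : K%:Z = \sum_j (k j)%:Z.
    by rewrite /K /mindex_size -natz natr_sum; apply: eq_bigr => j _; rewrite natz.
  rewrite exchange_big /=; apply: ler_sum => j _; rewrite km.
  by rewrite lerDl.
have : (size s)%:Z <= \sum_(n <- s) \sum_j n j /\
    forall n, n \in s -> \sum_j n j <= \sum_(n <- s) \sum_j n j.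
  elim: s deg1 {Xs km tot} => [|n s IH] deg1; first by rewrite big_nil.
  have [|ss sl] := IH; first by move=> n1 n1s; apply: deg1; rewrite inE n1s orbT.
  have [_ n1] := deg1 n (mem_head _ _).
  rewrite big_cons; split => [/=|n2]; first by rewrite -add1n PoszD lerD.
  rewrite inE => /orP[/eqP ->|/sl n2s].
    by rewrite lerDl; apply: le_trans ss.
  by apply: le_trans n2s _; rewrite lerDr; apply: le_trans n1.
move=> [ss sl]; split; first by rewrite -lez_nat; exact: le_trans tot.
move=> n ns j; have [nm1 n1] := deg1 _ ns.
rewrite nm1 /=; have := le_trans (sl _ ns) tot; rewrite (bigD1 j) //=.
have : - nu%:Z <= \sum_(i < nu | i != j) n i.
  apply: (@le_trans _ _ (\sum_(i < nu | i != j) (-1))); last exact: ler_sum.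
  rewrite sumrN lerN2 sumr_const -natz ler_nat.
  by apply: leq_trans (max_card _) _; rewrite card_ord.
move: (n j) (\sum_(i < nu | i != j) n i) => u v; lia.
Qed.

(* X = X_lin + sum_n D_n. *)
Lemma vf_act_hcomp X f k :
  vf_act X f k =
  vf_act (vf_lin X) f k + \sum_(n \in degrees X) hcomp X n f k.
Proof.
pose Y := vf_sub X (vf_lin X); pose S := [set p | @mindex_add nu p.1 p.2 = k].
have finS : finite_set S by exact: finite_fps_mul.
have -> : vf_act X f k = vf_act (vf_lin X) f k + vf_act Y f k.
  rewrite /vf_act -big_split /=; apply: eq_bigr => i _.
  rewrite /fps_mul -fsbig_split //=; apply: eq_fsbigr => p _.
  by rewrite -mulrDl /Y /vf_sub addrC subrK.
congr (_ + _).
pose B := [set n : degree nu | forall j, -1 <= n j <= (mindex_size k)%:Z].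
have finB : finite_set B by exact: finite_degree_le.
pose e (i : 'I_nu) (p : mindex nu) : degree nu :=
  [ffun j => (p j)%:Z - (j == i)%:Z].
have eB i p : S p -> B (e i p.1).
  move=> pqk j; rewrite ffunE; have : (p.1 j <= mindex_size k)%N.
    rewrite -pqk /mindex_size (bigD1 j) //= ffunE.
    by rewrite -addnA leq_addr.
  by case: (j == i) => /=; lia.
rewrite (fsbig_widen _ (degrees X `|` B)); first last.
- move=> n /= [_ nX]; have -> // : hcomp X n = (fun _ _ => 0).
  exact: contrapT.
- by move=> n; left.
rewrite -(fsbig_widen B); first last.
- move=> n /= [_ nB]; apply: big1 => i _; apply: fsbig1 => p pS.
  have [->|Zp] := eqVneq (vf_homog (vf_sub X (vf_lin X)) n i p.1) 0.
    by rewrite mul0r.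
  exfalso; apply: nB; have [pE _] := vf_homogE Zp.
  rewrite (_ : n = e i p.1); first exact: eB.
  by apply/ffunP => j; rewrite ffunE pE addrK.
- by move=> n; right.
rewrite fsbig_finite // exchange_big /=; apply: eq_bigr => i _.
rewrite -fsbig_finite // /fps_mul exchange_fsbig //; apply: eq_fsbigr => p.
rewrite inE => pS; rewrite -(fsbig_widen [set e i p.1]); first last.
- move=> n /= [_ ne]; have [->|Zp] := eqVneq (vf_homog Y n i p.1) 0.
    by rewrite mul0r.
  exfalso; apply: ne; have [pE _] := vf_homogE Zp.
  by apply/ffunP => j; rewrite ffunE pE addrK.
- by move=> _ ->; exact: eB.
rewrite fsbig_set1 /vf_homog ifT //; apply/forallP => j.
by rewrite ffunE subrK.
Qed.

End hcomp_theory.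

(* Main.v *)
Require Import Defs.
From mathcomp Require Import all_boot all_order all_algebra.
From mathcomp Require Import complex.
From mathcomp Require Import all_classical all_reals all_analysis.
From mathcomp Require Import zify ring.

(** Write Y = X - X_lin. Every word ending with n contributes to Na (D_n f), and
    multiplying Na^s by the sum of the omega_i removes its last letter. Hence
    X_lin Na - Na X_lin = Na Y (Na_monomial_hcomp), and the coefficients of Na x^m
    satisfy a recursion whose divisors are the elements of Omega
    (Na_monomial_rec).

    This recursion has at most one solution with given leading coefficients, and
    X_lin and Y are derivations; therefore Na is multiplicative on monomials
    (Na_monomial_mul). So Na x^p is the product of the series h_j = Na x_j
    according to p, and h solves the nonlinear system
      (k . lam - lam_i) [h_i]_k = [Y_i (h)]_k.
    No derivative of h occurs, and the divisors of the nonzero coefficients with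
    k <> e_i are bounded below by C. The method of majorants applies: h_i - x_i
    is dominated by the solution G of G_i = C^-1 |Y_i| (x + G), where |Y_i| has the
    absolute values of the coefficients of Y_i and starts in degree 2.

    The solution G is not constructed. Instead, the sum of |[h_i]_k| rho^|k| over
    |k| <= d is shown to be at most 2 rho, uniformly in d, by induction on d
    (tnorm_Na_var). The terms of Y_i (h) are products of at least two series
    without constant term, so that degree d + 1 of the product needs the factors
    only up to degree d (tnorm_mulS); and the majorant of Y_i at 2 rho is
    O(rho^2), hence at most C rho for small rho. *)

Set Implicit Arguments.
Unset Strict Implicit.
Unset Printing Implicit Defensive.

Import Order.TTheory GRing.Theory Num.Theory.
Local Open Scope classical_set_scope.
Local Open Scope ring_scope.

(** * Modulus, monomials and finite sums of exponents *)

Section Modulus.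
Variable R : realType.
Implicit Types x y z : R[i].

Lemma cmodE z : `|z| = (cmod z)%:C%C.
Proof. by rewrite /cmod normc_def. Qed.

Lemma cmodM x y : cmod (x * y) = cmod x * cmod y.
Proof. by apply: complexI; rewrite rmorphM /= -!cmodE normrM. Qed.

Lemma cmod_ge0 z : 0 <= cmod z.
Proof. by rewrite -lecR -cmodE normr_ge0. Qed.

Lemma cmod_le_sum (I : Type) (r : seq I) (P : pred I) (F : I -> R[i]) :
  cmod (\sum_(i <- r | P i) F i) <= \sum_(i <- r | P i) cmod (F i).
Proof.
rewrite -lecR -cmodE rmorph_sum /=; apply: le_trans (ler_norm_sum _ _ _) _.
by rewrite (eq_bigr _ (fun i _ => cmodE (F i))).
Qed.

Lemma cmodX z n : cmod (z ^+ n) = cmod z ^+ n.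
Proof. by apply: complexI; rewrite rmorphXn /= -!cmodE normrX. Qed.

Lemma cmod_prod (I : Type) (r : seq I) (F : I -> R[i]) :
  cmod (\prod_(i <- r) F i) = \prod_(i <- r) cmod (F i).
Proof.
apply: complexI; rewrite rmorph_prod /= -!cmodE normr_prod.
by apply: eq_bigr => i _; rewrite cmodE.
Qed.

Lemma cmod_real (r : R) : 0 <= r -> cmod r%:C%C = r.
Proof. by move=> r0; apply: complexI; rewrite -cmodE ger0_norm // lecR. Qed.

Lemma cmod0 : cmod (0 : R[i]) = 0.
Proof. exact: cmod_real. Qed.

Lemma cmod1 : cmod (1 : R[i]) = 1.
Proof. exact: cmod_real. Qed.

Lemma cmod_eq0 z : (cmod z == 0) = (z == 0).
Proof. by rewrite -[in RHS]normr_eq0 cmodE -(inj_eq (@complexI _)). Qed.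

End Modulus.

Section Monomials.
Variables (R : realType) (nu : nat).
Implicit Types (m k p q : mindex nu) (n : degree nu) (f g : fps R nu).

Definition monomial m : fps R nu := fun k => (k == m)%:R.

(** x^(m + n) for an exponent m and a degree n; a negative entry of m + n is
    replaced by its absolute value, which matters only for zero coefficients
    (see dcoef_neq0). *)
Definition mshift m n : mindex nu := [ffun j => absz ((m j)%:Z + n j)].

Lemma mindex_size_sum m : (mindex_size m)%:Z = \sum_j (m j)%:Z.
Proof.
by rewrite /mindex_size -natz natr_sum; apply: eq_bigr => j _; rewrite natz.
Qed.

Lemma mindex_size_add m k :
  mindex_size (mindex_add m k) = (mindex_size m + mindex_size k)%N.
Proof.
by rewrite /mindex_size -big_split; apply: eq_bigr => j _; rewrite ffunE.
Qed.

Lemma mindex_addC m m' : mindex_add m m' = mindex_add m' m.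
Proof. by apply/ffunP => j; rewrite !ffunE addnC. Qed.

Lemma mindex_size1 (i : 'I_nu) : mindex_size (mindex1 i) = 1%N.
Proof.
rewrite /mindex_size (bigD1 i) //= ffunE eqxx big1 // => j /negbTE ji.
by rewrite ffunE ji.
Qed.

Lemma mindex_add_subr m (i : 'I_nu) : m i != 0%N ->
  exists2 q, m = mindex_add (mindex1 i) q & mindex_size m = (mindex_size q).+1.
Proof.
move=> mi; pose q : mindex nu := [ffun j => (m j - (j == i))%N].
have mE : m = mindex_add (mindex1 i) q.
  apply/ffunP => j; rewrite !ffunE; have [->|ji] := eqVneq j i => /=; lia.
by exists q => //; rewrite {1}mE mindex_size_add mindex_size1.
Qed.

Lemma mindex_size_gt0 m : (0 < mindex_size m)%N -> exists i, m i != 0%N.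
Proof.
move=> m0; apply/existsP; apply: contraTT m0 => /existsPn m0.
by rewrite /mindex_size big1 // => i _; apply/eqP/negPn.
Qed.

Lemma finite_mindex_size d : finite_set [set m : mindex nu | (mindex_size m <= d)%N].
Proof.
apply: (sub_finite_set _ (@finite_mindex_le nu d)) => m /= md j.
by apply: leq_trans md; rewrite /mindex_size (bigD1 j) //= leq_addr.
Qed.

Definition mball d : seq (mindex nu) :=
  finmap.enum_fset (fset_set [set m : mindex nu | (mindex_size m <= d)%N]).

Lemma mem_mball d m : (m \in mball d) = (mindex_size m <= d)%N.
Proof.
rewrite /mball in_fset_set; last exact: finite_mindex_size.
by apply/idP/idP; rewrite inE.
Qed.

Lemma mball_uniq d : uniq (mball d). Proof. exact: finmap.fset_uniq. Qed.

Definition degball d : seq (degree nu) :=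
  finmap.enum_fset (fset_set [set n : degree nu | forall j, -1 <= n j <= d%:Z]).

Lemma degballP d n : reflect (forall j, -1 <= n j <= d%:Z) (n \in degball d).
Proof.
rewrite /degball in_fset_set; last exact: finite_degree_le.
by apply: (iffP idP); rewrite inE.
Qed.

Lemma degball_uniq d : uniq (degball d). Proof. exact: finmap.fset_uniq. Qed.

Lemma fps_mul_neq0 (f g : fps R nu) k : fps_mul f g k != 0 ->
  exists p q, [/\ mindex_add p q = k, f p != 0 & g q != 0].
Proof.
move=> h; apply: contrapT => fg0; case/eqP: h; apply: fsbig1 => -[p q] /= pqk.
have [->|fp] := eqVneq (f p) 0; first by rewrite mul0r.
have [->|gq] := eqVneq (g q) 0; first by rewrite mulr0.
by case: fg0; exists p, q.
Qed.

Lemma fps_mul_fset (f g : fps R nu) k : fps_mul f g k =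
  \sum_(u <- finmap.enum_fset
            (fset_set [set u : mindex nu * mindex nu | mindex_add u.1 u.2 = k]))
    f u.1 * g u.2.
Proof. by rewrite /fps_mul fsbig_finite //; exact: finite_fps_mul. Qed.

(** The product as a double sum over a fixed ball, so that it can be exchanged
    with other finite sums. Only nonzero products f p * g q have to lie in the
    ball: for series without constant term the radius can then be one less than
    the size of k. *)
Lemma fps_mul_ball d f g k :
  (forall p q, mindex_add p q = k -> f p * g q != 0 ->
     (mindex_size p <= d)%N && (mindex_size q <= d)%N) ->
  fps_mul f g k =
  \sum_(p <- mball d) \sum_(q <- mball d | mindex_add p q == k) f p * g q.
Proof.
move=> fgd.
pose r := [seq (p, q) | p <- mball d, q <- [seq q <- mball d | mindex_add p q == k]].
have rP p q : ((p, q) \in r) =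
    [&& mindex_size p <= d, mindex_size q <= d & mindex_add p q == k]%N.
  apply/allpairsPdep/and3P => [[p' [q' [+ + [-> ->]]]]|[pd qd pqk]].
    by rewrite mem_filter !mem_mball => ? /andP[].
  by exists p, q; rewrite mem_filter !mem_mball pd qd pqk.
rewrite /fps_mul (fsbigE r).
- rewrite big_mkcond /= big_allpairs_dep /=; apply: eq_bigr => p _.
  rewrite big_filter; apply: eq_bigr => q /eqP pqk.
  by rewrite ifT // inE.
- apply: allpairs_uniq_dep => [|p _|]; first exact: mball_uniq.
    by apply: filter_uniq; exact: mball_uniq.
  by move=> [? ?] [? ?] _ _ /= [-> ->].
- by move=> [p q] /=; rewrite rP => /and3P[_ _ /eqP].
- move=> [p q] /= pqk; rewrite rP pqk eqxx andbT => npq.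
  by apply/eqP; apply: contraNT npq; exact: fgd.
Qed.

End Monomials.

(** * Action of the homogeneous components on monomials *)

Section Homogeneous.
Variables (R : realType) (nu : nat) (X : vfield R nu).
Implicit Types (m k p q : mindex nu) (n : degree nu) (f g : fps R nu).

(** The number c_(n, m) with D_n x^m = c_(n, m) x^(n + m). Additivity in m is
    the Leibniz rule for D_n on monomials. *)
Definition dcoef n m : R[i] :=
  \sum_j (m j)%:R *
    vf_homog (vf_sub X (vf_lin X)) n j (mshift (mindex1 j) n).

Lemma vf_homog_mshift (Y : vfield R nu) n j p :
  vf_homog Y n j p != 0 -> p = mshift (mindex1 j) n.
Proof.
move=> /vf_homogE[pE _]; apply/ffunP => l.
by rewrite !ffunE addrC -pE absz_nat.
Qed.

(** In the j-th component of the degree-n part only the monomial x^n x_j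
    survives, and d/dx_j x^m = m_j x^m / x_j. *)
Lemma hcomp_monomial n m :
  hcomp X n (monomial R m) = fun k => dcoef n m * monomial R (mshift m n) k.
Proof.
apply/funext => k; rewrite mulr_suml; apply: eq_bigr => j _.
set Z := vf_homog _ n j; pose a := mshift (mindex1 j) n; rewrite -/a.
have Zoff p : p != a -> Z p = 0.
  by move=> pa; apply/eqP; apply: contraNT pa => /vf_homog_mshift/eqP.
have [Za0|Za] := eqVneq (Z a) 0.
  rewrite Za0 mulr0 mul0r; apply: fsbig1 => -[p q] /= _.
  by have [->|/Zoff->] := eqVneq p a; rewrite ?Za0 mul0r.
have [aE _] := vf_homogE Za.
have [mj0|mj] := eqVneq (m j) 0%N.
  rewrite mj0 !mul0r; apply: fsbig1 => -[p q] /= _.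
  rewrite /fps_deriv /monomial; case: eqP => [qm|_]; last by rewrite !mulr0.
  by move: mj0; rewrite -qm !ffunE eqxx addn1.
have [q mE _] := mindex_add_subr mj.
have kE : mindex_add a q = mshift m n.
  apply/ffunP => l; have := aE l; rewrite mE !ffunE.
  by move: (n l) (q l) => u v; case: (l == j) => /=; lia.
have derE q' : fps_deriv j (monomial R m) q' = (m j)%:R * monomial R q q'.
  rewrite /fps_deriv /monomial.
  have -> : (mindex_add q' (mindex1 j) == m) = (q' == q).
    rewrite mE; apply/eqP/eqP => [/ffunP qq|->].
      by apply/ffunP => l; have := qq l; rewrite !ffunE addnC => /addnI.
    by apply/ffunP => l; rewrite !ffunE addnC.
  case: eqP => [->|_]; last by rewrite !mulr0.
  by rewrite mE !ffunE eqxx.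
rewrite /fps_mul; have [kmn|kmn] := eqVneq k (mshift m n).
  rewrite -(fsbig_widen [set (a, q)]); first last.
  - move=> [p' q'] /= [pqk pq]; rewrite derE /monomial.
    have [pa|/Zoff->] := eqVneq p' a; last by rewrite mul0r.
    case: eqP => [qq|_]; last by rewrite !mulr0.
    by case: pq; rewrite pa qq.
  - by move=> _ ->; rewrite /= kE.
  by rewrite fsbig_set1 derE /monomial kmn !eqxx !mulr1 mulrC.
rewrite [monomial _ _ _](_ : _ = 0) ?mulr0; last by rewrite /monomial (negbTE kmn).
apply: fsbig1 => -[p' q'] /= pqk; rewrite derE /monomial.
have [pa|/Zoff->] := eqVneq p' a; last by rewrite mul0r.
case: eqP => [qq|_]; last by rewrite !mulr0.
by move: kmn; rewrite -pqk pa qq kE eqxx.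
Qed.

Lemma dcoefD n m m' : dcoef n (mindex_add m m') = dcoef n m + dcoef n m'.
Proof.
rewrite -big_split; apply: eq_bigr => j _.
by rewrite ffunE natrD mulrDl.
Qed.

Lemma dcoef_mindex1 n i :
  dcoef n (mindex1 i) =
  vf_homog (vf_sub X (vf_lin X)) n i (mshift (mindex1 i) n).
Proof.
rewrite /dcoef (bigD1 i) //= ffunE eqxx mul1r big1 ?addr0 // => j /negbTE ji.
by rewrite ffunE ji mul0r.
Qed.

Lemma hcomp_monomial_neq0 n m k : hcomp X n (monomial R m) k != 0 ->
  forall j, (k j)%:Z = n j + (m j)%:Z.
Proof.
move=> /hcomp_neq0[m' kE]; rewrite /monomial.
by case: (m' =P m) => [<-//|_]; rewrite eqxx.
Qed.

Lemma dcoef_neq0 n m : dcoef n m != 0 ->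
  degrees X n /\ (forall j, (mshift m n j)%:Z = (m j)%:Z + n j).
Proof.
move=> c0; have hc : hcomp X n (monomial R m) (mshift m n) != 0.
  by rewrite hcomp_monomial /monomial eqxx mulr1.
split; first by move=> h0; rewrite h0 eqxx in hc.
by move=> j; rewrite (hcomp_monomial_neq0 hc) addrC.
Qed.

Lemma mindex_size_mshift n m : (forall j, (mshift m n j)%:Z = (m j)%:Z + n j) ->
  (mindex_size (mshift m n))%:Z = (mindex_size m)%:Z + \sum_j n j.
Proof.
by move=> e; rewrite !mindex_size_sum -big_split; apply: eq_bigr => j _; rewrite e.
Qed.

Hypothesis X0 : forall i, X i [ffun=> 0%N] = 0.

Lemma dcoef_size n m : dcoef n m != 0 ->
  (mindex_size m < mindex_size (mshift m n))%N.
Proof.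
move=> /dcoef_neq0[/(degreesP X0)[_ n1] /mindex_size_mshift e].
by rewrite -ltz_nat e ltrDl; apply: lt_le_trans n1.
Qed.

Lemma dcoef_degball n m d : dcoef n m != 0 ->
  (mindex_size (mshift m n) <= d)%N -> n \in degball nu d.
Proof.
move=> /dcoef_neq0[/(degreesP X0)[[i ni] _] e] md; apply/degballP => j.
have : (mshift m n j <= d)%N.
  by apply: leq_trans md; rewrite /mindex_size (bigD1 j) //= leq_addr.
have := ni j; rewrite -lez_nat e; case: (j == i) => /=; lia.
Qed.

Lemma mshiftD n m m' : dcoef n m != 0 ->
  mshift (mindex_add m m') n = mindex_add (mshift m n) m'.
Proof.
move=> /dcoef_neq0[_ e]; apply/ffunP => j; have := e j; rewrite !ffunE; lia.
Qed.

End Homogeneous.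

(** * The linearization equation *)

Section Recursion.
Variables (R : realType) (nu : nat) (X : vfield R nu) (lam : 'I_nu -> R[i]).
Implicit Types (m k p q : mindex nu) (n : degree nu) (s : seq (degree nu)).
Implicit Types (f g : fps R nu).

(** The eigenvalue of x^m for the diagonal field sum_i lam_i x_i d/dx_i. *)
Definition weight m : R[i] := \sum_j (m j)%:R * lam j.

Lemma weightD m m' : weight (mindex_add m m') = weight m + weight m'.
Proof.
by rewrite -big_split; apply: eq_bigr => j _; rewrite ffunE natrD mulrDl.
Qed.

Lemma pairing_sum s : pairing (\sum_(n <- s) n) lam = \sum_(n <- s) pairing n lam.
Proof.
rewrite exchange_big; apply: eq_bigr => i _ /=.
by rewrite sum_ffunE rmorph_sum mulr_suml.
Qed.

Lemma Na_scale c f k : Na X lam (fun l => c * f l) k = c * Na X lam f k.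
Proof.
have hcompZ n g : hcomp X n (fun l => c * g l) = fun l => c * hcomp X n g l.
  apply/funext => l; rewrite mulr_sumr; apply: eq_bigr => i _.
  rewrite mulr_fsumr; apply: eq_fsbigr => p _.
  by rewrite /fps_deriv; ring.
have wordZ s : hcomp_word X s (fun l => c * f l) = fun l => c * hcomp_word X s f l.
  by elim: s => //= n s ->; rewrite hcompZ.
rewrite mulr_fsumr; apply: eq_fsbigr => s _.
by rewrite wordZ mulrCA.
Qed.

Lemma hcomp_word_monomial s m k : hcomp_word X s (monomial R m) k != 0 ->
  forall j, (k j)%:Z = \sum_(n <- s) n j + (m j)%:Z.
Proof.
move=> /hcomp_word_neq0[m' kE]; rewrite /monomial.
by case: (m' =P m) => [<-//|_]; rewrite eqxx.
Qed.

Lemma word_weight s m k : hcomp_word X s (monomial R m) k != 0 ->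
  \sum_(n <- s) pairing n lam = weight k - weight m.
Proof.
move=> /hcomp_word_monomial kE; rewrite -sumrB exchange_big.
apply: eq_bigr => i _ /=; rewrite -mulr_suml -rmorph_sum -mulrBl.
congr (_ * _); have -> : \sum_(n <- s) n i = (k i)%:Z - (m i)%:Z.
  by rewrite kE addrK.
by rewrite rmorphB.
Qed.

Hypothesis X0 : forall i, X i [ffun=> 0%N] = 0.

Lemma word_size s m k : words X s -> hcomp_word X s (monomial R m) k != 0 ->
  (mindex_size m + size s <= mindex_size k)%N.
Proof.
move=> Xs /hcomp_word_monomial kE.
have kmE : (mindex_size k)%:Z = \sum_(n <- s) \sum_j n j + (mindex_size m)%:Z.
  rewrite exchange_big !mindex_size_sum /= -big_split /=.
  by apply: eq_bigr => j _; exact: kE.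
rewrite -lez_nat PoszD kmE addrC lerD2r.
elim: s Xs {kE kmE} => [|n s IH] Xs; first by rewrite big_nil.
rewrite big_cons /= -add1n PoszD lerD //.
  by have [_] := degreesP X0 (Xs n (mem_head _ _)).
by apply: IH => n' n's; apply: Xs; rewrite inE n's orbT.
Qed.

Lemma Na_monomial_neq0 m k : Na X lam (monomial R m) k != 0 ->
  exists2 s, words X s & hcomp_word X s (monomial R m) k != 0.
Proof.
move=> h; apply: contrapT => /forall2NP D0; case/eqP: h.
apply: fsbig1 => s Xs; have [//|/negP] := D0 s.
by rewrite negbK => /eqP ->; rewrite mulr0.
Qed.

Lemma Na_monomial_size m k : Na X lam (monomial R m) k != 0 ->
  (mindex_size m <= mindex_size k)%N.
Proof.
move=> /Na_monomial_neq0[s Xs /(word_size Xs)]; apply: leq_trans.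
exact: leq_addr.
Qed.

Lemma Na_monomial_diag m : Na X lam (monomial R m) m = 1.
Proof.
rewrite /Na -(fsbig_widen [set [::]]) => [|_ -> //|s [/= Xs s0]].
  by rewrite fsbig_set1 /Na_coef /= big_geq // invr1 mul1r /monomial eqxx.
apply/eqP; apply: contrapT => /negP; rewrite mulf_eq0 negb_or => /andP[_].
move=> /(word_size Xs); rewrite -[X in (_ <= X)%N]addn0 leq_add2l leqn0.
by move=> /nilP.
Qed.

Hypothesis Omega_neq0 : forall w, Omega X lam w -> w != 0.

Lemma word_weight_neq0 s : words X s -> s <> [::] ->
  \sum_(n <- s) pairing n lam != 0.
Proof. by move=> Xs s0; apply: Omega_neq0; exists s; rewrite pairing_sum. Qed.

(** The last factor of the denominator of Na^s is the sum over the whole word,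
    so a word loses its last letter when Na^s is multiplied by that sum. *)
Lemma Na_coef_rcons s n : words X (rcons s n) ->
  (\sum_(n' <- rcons s n) pairing n' lam) * Na_coef lam (rcons s n) =
  Na_coef lam s.
Proof.
move=> Xsn; rewrite /Na_coef size_rcons big_nat_recr //= invfM mulrA.
rewrite take_oversize ?size_rcons // mulrAC mulfV ?mul1r; last first.
  by apply: word_weight_neq0 => //; case: (s).
congr (_^-1); apply: eq_big_nat => l /andP[_ ls].
by rewrite -cats1 takel_cat.
Qed.

(** The linearization equation X_lin Na - Na X_lin = Na (X - X_lin), evaluated on
    x^m. If x^k occurs in D_s x^m, the sum of omega_i over s is the difference
    of the weights of k and m; it turns Na^(s' n) into Na^s', and
    D_(s' n) = D_s' D_n, so the words ending with n add up to Na (D_n x^m). *)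
Lemma Na_monomial_hcomp m k :
  (weight k - weight m) * Na X lam (monomial R m) k =
  \sum_(n \in degrees X) Na X lam (hcomp X n (monomial R m)) k.
Proof.
pose D s := hcomp_word X s (monomial R m) k.
pose S := [set s | words X s /\ D s != 0].
have finS : finite_set S by exact: Na_finite.
pose N := [set n | exists s, S (rcons s n)].
pose W := [set s | exists n, S (rcons s n)].
have finN : finite_set N.
  apply: (sub_finite_set _ (finite_image (last 0) finS)) => n [s Ssn].
  by exists (rcons s n) => //; rewrite last_rcons.
have finW : finite_set W.
  apply: (sub_finite_set _ (finite_image (rev \o behead \o rev) finS)) => s [n Ssn].
  by exists (rcons s n) => //=; rewrite rev_rcons /= revK.
have words_rcons s n : words X (rcons s n) -> words X s /\ degrees X n.
  move=> Xsn; split=> [n' n's|]; apply: Xsn; rewrite mem_rcons ?mem_head //.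
  by rewrite inE n's orbT.
have D_rcons s n : hcomp_word X s (hcomp X n (monomial R m)) k = D (rcons s n).
  by rewrite /D /hcomp_word foldr_rcons.
pose F s := (weight k - weight m) * (Na_coef lam s * D s).
have F_rcons s n : words X (rcons s n) ->
    F (rcons s n) = Na_coef lam s * D (rcons s n).
  move=> Xsn; have [D0|D0] := eqVneq (D (rcons s n)) 0.
    by rewrite /F D0 !mulr0.
  by rewrite /F -(word_weight D0) mulrA Na_coef_rcons.
have NX n : N n -> degrees X n by move=> [s [/words_rcons[]]].
have WX s : W s -> words X s by move=> [n [/words_rcons[]]].
have rcons_words s n : words X s -> degrees X n -> words X (rcons s n).
  by move=> Xs Xn n'; rewrite mem_rcons inE => /orP[/eqP->//|/Xs].
have D0 s : words X s -> ~ S s -> D s = 0.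
  by move=> Xs nSs; apply/eqP; apply: contra_notT nSs => Ds; split.
rewrite /Na mulr_fsumr.
transitivity (\sum_(u \in N `*` W) F (rcons u.2 u.1)).
  rewrite -(@fsbig_image _ _ _ _ _ (N `*` W) (fun u => rcons u.2 u.1) F); last first.
    by move=> [? ?] [? ?] _ _ /= /rcons_inj[-> ->].
  apply/esym/fsbig_widen.
    by move=> _ [[n s] [/= /NX Xn /WX Xs] <-]; exact: rcons_words.
  (* The empty word contributes only when k = m, with a zero weight. *)
  move=> s [/= Xs NWs]; change (F s = 0).
  case/lastP: s Xs NWs => [|s n] Xs NWs.
    have [Dnil|Dnil] := eqVneq (D [::]) 0; first by rewrite /F Dnil !mulr0.
    by rewrite /F -(word_weight Dnil) big_nil mul0r.
  rewrite /F (D0 _ Xs) ?mulr0 // => Ssn.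
  by apply: NWs; exists (n, s) => //; split; [exists s|exists n].
rewrite -(@pair_fsbig _ _ _ _ _ N W (fun n s => F (rcons s n))) //.
pose G n s := Na_coef lam s * hcomp_word X s (hcomp X n (monomial R m)) k.
have G0 n s : degrees X n -> words X s -> ~ S (rcons s n) -> G n s = 0.
  by move=> Xn Xs nS; rewrite /G D_rcons D0 ?mulr0 //; exact: rcons_words.
rewrite -[RHS](@fsbig_widen _ _ _ _ N) => [|n /NX //|n [/= Xn nN]]; last first.
  apply: fsbig1 => s Xs; change (G n s = 0); apply: G0 => // Ssn.
  by apply: nN; exists s.
apply: eq_fsbigr => n /set_mem/NX Xn.
rewrite -[RHS](@fsbig_widen _ _ _ _ W _ (G n)) => [|s /WX //|s [/= Xs nW]]; last first.
  by change (G n s = 0); apply: G0 => // Ssn; apply: nW; exists n.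
apply: eq_fsbigr => s /set_mem/WX Xs.
by rewrite F_rcons /G ?D_rcons //; exact: rcons_words.
Qed.

(** Coefficient form: since D_n x^m is a multiple of x^(m + n), the coefficients
    of x^k in Na x^m satisfy a linear recursion. All degrees that contribute lie
    in a finite set depending only on the size of k. *)
Lemma Na_monomial_rec d m k : (mindex_size k <= d)%N ->
  (weight k - weight m) * Na X lam (monomial R m) k =
  \sum_(n <- degball nu d)
    dcoef X n m * Na X lam (monomial R (mshift m n)) k.
Proof.
move=> kd; rewrite Na_monomial_hcomp [RHS]fsbig_seq ?degball_uniq //.
transitivity (\sum_(n \in degrees X)
    dcoef X n m * Na X lam (monomial R (mshift m n)) k).
  by apply: eq_fsbigr => n _; rewrite hcomp_monomial Na_scale.
rewrite [LHS](@fsbig_widen _ _ _ _ _ setT) //; last first.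
  move=> n [_ /= nX]; have [->|/dcoef_neq0[//]] := eqVneq (dcoef X n m) 0.
  by rewrite mul0r.
apply/esym/fsbig_widen => // n [_ nd] /=.
have [->|cn] := eqVneq (dcoef X n m) 0; first by rewrite mul0r.
have [->|Na0] := eqVneq (Na X lam (monomial R (mshift m n)) k) 0.
  by rewrite mulr0.
case: nd => /=; apply: (dcoef_degball X0 cn).
exact: leq_trans (Na_monomial_size Na0) kd.
Qed.

End Recursion.

(** * Multiplicativity of the linearizing operator *)

Section Multiplicativity.
Variables (R : realType) (nu : nat) (X : vfield R nu) (lam : 'I_nu -> R[i]).
Implicit Types (m k p q : mindex nu) (n : degree nu).
Hypothesis X0 : forall i, X i [ffun=> 0%N] = 0.
Hypothesis Omega_neq0 : forall w, Omega X lam w -> w != 0.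

(** A nonzero coefficient of x^k in Na x^m yields a word of A^*(X) whose
    divisor is the difference of weights; this makes the difference of weights
    accessible to the hypothesis on Omega. *)
Lemma Na_monomial_word m k : Na X lam (monomial R m) k != 0 ->
  exists s, [/\ words X s, \sum_(n <- s) pairing n lam = weight lam k - weight lam m
              & s = [::] -> k = m].
Proof.
move=> /Na_monomial_neq0[s Xs Ds]; exists s; split => //.
  exact: word_weight Ds.
move=> s0; have kE := hcomp_word_monomial Ds.
by apply/ffunP => j; have := kE j; rewrite s0 big_nil add0r => -[].
Qed.

(** Na is multiplicative. As X_lin and the D_n are derivations, Na (x^m x^m')
    and (Na x^m)(Na x^m') satisfy the same recursion in (m, m'), in which every
    D_n raises the total degree. Both have coefficient 1 at m + m'. At any other
    k the recursion determines the coefficient if the weights of k and m + m'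
    differ; if they agree, then both coefficients vanish. This replaces the
    shuffle relations for Na^s. The induction is on the amount by which the size
    of k exceeds those of m1 and m2. *)
Lemma Na_monomial_mul m m' :
  Na X lam (monomial R (mindex_add m m')) =
  fps_mul (Na X lam (monomial R m)) (Na X lam (monomial R m')).
Proof.
pose a m k := Na X lam (monomial R m) k.
suff mulE d m1 m2 k : (mindex_size k < mindex_size m1 + mindex_size m2 + d)%N ->
    a (mindex_add m1 m2) k = fps_mul (a m1) (a m2) k.
  by apply/funext => k; apply: (mulE (mindex_size k).+1); lia.
elim: d m1 m2 k => [|d IH] m1 m2 k kd.
  transitivity (0 : R[i]).
    apply/eqP; apply: contraTT kd => /(Na_monomial_size X0).
    by rewrite mindex_size_add addn0 -leqNgt.
  apply/esym/eqP; apply: contraTT kd => /fps_mul_neq0[p [q [<-]]].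
  move=> /(Na_monomial_size X0) mp /(Na_monomial_size X0) mq.
  by rewrite addn0 -leqNgt mindex_size_add leq_add.
have word0 s : words X s -> \sum_(n <- s) pairing n lam = 0 -> s = [::].
  by move=> Xs s0; apply: contrapT => /(word_weight_neq0 Omega_neq0 Xs)/eqP.
have [->|km] := eqVneq k (mindex_add m1 m2).
  rewrite /a Na_monomial_diag // /fps_mul -(fsbig_widen [set (m1, m2)]).
  - by rewrite fsbig_set1 /= !Na_monomial_diag // mulr1.
  - by move=> _ ->.
  move=> [p q] /= [pq npq].
  have [->|ap] := eqVneq (Na X lam (monomial R m1) p) 0; first by rewrite mul0r.
  have [->|aq] := eqVneq (Na X lam (monomial R m2) q) 0; first by rewrite mulr0.
  have [s1 [Xs1 s1E s10]] := Na_monomial_word ap.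
  have [s2 [Xs2 s2E s20]] := Na_monomial_word aq.
  have : s1 ++ s2 = [::].
    apply: word0; first by move=> n; rewrite mem_cat => /orP[/Xs1|/Xs2].
    by rewrite big_cat /= s1E s2E addrACA -opprD -!weightD pq subrr.
  by move=> /nilP; rewrite cat_nilp => /andP[/nilP/s10 pE /nilP/s20 qE];
    case: npq; rewrite pE qE.
pose delta := weight lam k - weight lam (mindex_add m1 m2).
have [delta0|delta_neq0] := eqVneq delta 0.
  transitivity (0 : R[i]).
    apply/eqP; apply: contraNT km => /Na_monomial_word[s [Xs sE s0]].
    by apply/eqP/s0/word0; rewrite // sE.
  apply/esym/eqP; apply: contraNT km => /fps_mul_neq0[p [q [pq ap aq]]].
  have [s1 [Xs1 s1E s10]] := Na_monomial_word ap.
  have [s2 [Xs2 s2E s20]] := Na_monomial_word aq.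
  have : s1 ++ s2 = [::].
    apply: word0; first by move=> n; rewrite mem_cat => /orP[/Xs1|/Xs2].
    by rewrite big_cat /= s1E s2E addrACA -opprD -!weightD pq.
  by move=> /nilP; rewrite cat_nilp => /andP[/nilP/s10 pE /nilP/s20 qE];
    rewrite -pq pE qE.
apply: (mulfI delta_neq0).
rewrite [LHS](Na_monomial_rec X0 Omega_neq0 _ (leqnn _)).
set B := degball _ _.
have shiftE n l l' : dcoef X n l != 0 ->
    (mindex_size k < mindex_size l + mindex_size l' + d.+1)%N ->
    fps_mul (a (mshift l n)) (a l') k = a (mshift (mindex_add l l') n) k.
  move=> cn kl; rewrite (mshiftD _ cn) IH //.
  by have := dcoef_size X0 cn; lia.
transitivity (\sum_(n <- B) dcoef X n m1 * fps_mul (a (mshift m1 n)) (a m2) k +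
    \sum_(n <- B) dcoef X n m2 * fps_mul (a m1) (a (mshift m2 n)) k).
  rewrite -big_split; apply: eq_bigr => n _; rewrite dcoefD mulrDl; congr (_ + _).
    have [->|cn] := eqVneq (dcoef X n m1) 0; first by rewrite !mul0r.
    by rewrite shiftE.
  have [->|cn] := eqVneq (dcoef X n m2) 0; first by rewrite !mul0r.
  rewrite mindex_addC (mshiftD _ cn) mindex_addC -IH //.
  by have := dcoef_size X0 cn; lia.
rewrite fps_mul_fset mulr_sumr.
under eq_bigr => n _ do rewrite fps_mul_fset mulr_sumr.
under [X in _ + X]eq_bigr => n _ do rewrite fps_mul_fset mulr_sumr.
rewrite exchange_big [X in _ + X]exchange_big -big_split /=.
rewrite big_seq [RHS]big_seq; apply: eq_bigr => -[p q].
rewrite in_fset_set; last exact: finite_fps_mul.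
rewrite inE /= => pqk.
have -> : delta = (weight lam p - weight lam m1) + (weight lam q - weight lam m2).
  by rewrite /delta -pqk !weightD; ring.
have rec l' l : (mindex_size l <= mindex_size k)%N ->
    (weight lam l - weight lam l') * a l' l =
    \sum_(n <- B) dcoef X n l' * a (mshift l' n) l.
  exact: Na_monomial_rec.
rewrite mulrDl mulrA rec; last by rewrite -pqk mindex_size_add leq_addr.
rewrite [X in _ = _ + X]mulrCA rec; last by rewrite -pqk mindex_size_add leq_addl.
rewrite mulr_suml mulr_sumr; congr (_ + _); apply: eq_bigr => n _.
  by rewrite mulrA.
by rewrite mulrCA.
Qed.

End Multiplicativity.

(** * Truncated norms *)

Section TruncatedNorm.
Variables (R : realType) (nu : nat) (rho : R).
Implicit Types (m k p q : mindex nu) (f g : fps R nu).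
Hypothesis rho_ge0 : 0 <= rho.

(** The l^1 norm of the Taylor polynomial of degree d on the polydisc of
    radius rho. *)
Definition tnorm d f : R := \sum_(k <- mball nu d) cmod (f k) * rho ^+ mindex_size k.

Lemma ler_sum_sub (T : eqType) (r r' : seq T) (F : T -> R) :
  uniq r -> uniq r' -> {subset r <= r'} -> (forall x, 0 <= F x) ->
  \sum_(x <- r) F x <= \sum_(x <- r') F x.
Proof.
move=> ur ur' rr' F0; rewrite [leRHS](bigID (mem r)) /=.
have rE : perm_eq [seq x <- r' | x \in r] r.
  apply: uniq_perm => //; first exact: filter_uniq.
  by move=> x; rewrite mem_filter /=; apply: andb_idr => /rr'.
by rewrite -[X in _ <= X + _]big_filter (perm_big _ rE) lerDl sumr_ge0.
Qed.

Lemma tnorm_term_ge0 f k : 0 <= cmod (f k) * rho ^+ mindex_size k.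
Proof. by rewrite mulr_ge0 ?cmod_ge0 ?exprn_ge0. Qed.

Lemma tnorm_ge0 d f : 0 <= tnorm d f.
Proof. by apply: sumr_ge0 => k _; exact: tnorm_term_ge0. Qed.

Lemma tnorm_leS d f : tnorm d f <= tnorm d.+1 f.
Proof.
apply: ler_sum_sub => [|||k]; [exact: mball_uniq|exact: mball_uniq| |].
  by move=> k; rewrite !mem_mball => /leqW.
exact: tnorm_term_ge0.
Qed.

(** Without constant terms, a product up to degree d + 1 involves its factors
    only up to degree d. This is the gain that makes the fixed point estimate
    below an induction on d. *)
Lemma tnorm_mulS d f g : f [ffun=> 0%N] = 0 -> g [ffun=> 0%N] = 0 ->
  tnorm d.+1 (fps_mul f g) <= tnorm d f * tnorm d g.
Proof.
move=> f0 g0; have size_gt0 (h : fps R nu) p :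
    h [ffun=> 0%N] = 0 -> h p != 0 -> (0 < mindex_size p)%N.
  move=> h0; rewrite lt0n; apply: contra => /eqP p0.
  rewrite (_ : p = [ffun=> 0%N]) ?h0 //; apply/ffunP => j; rewrite ffunE.
  by move: p0; rewrite /mindex_size (bigD1 j) //=; lia.
pose t p q := (cmod (f p) * rho ^+ mindex_size p) *
              (cmod (g q) * rho ^+ mindex_size q).
have t_ge0 p q : 0 <= t p q by rewrite mulr_ge0 ?tnorm_term_ge0.
apply: (@le_trans _ _ (\sum_(k <- mball nu d.+1) \sum_(p <- mball nu d)
    \sum_(q <- mball nu d | mindex_add p q == k) t p q)).
  rewrite /tnorm big_seq [leRHS]big_seq; apply: ler_sum => k.
  rewrite mem_mball => kd; rewrite (@fps_mul_ball _ _ d); last first.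
    move=> p q pqk; rewrite mulf_eq0 negb_or => /andP[/(size_gt0 _ _ f0) p0].
    move=> /(size_gt0 _ _ g0) q0; move: kd; rewrite -pqk mindex_size_add; lia.
  apply: le_trans (ler_wpM2r (exprn_ge0 _ rho_ge0) (cmod_le_sum _ _ _)) _.
  rewrite mulr_suml; apply: ler_sum => p _.
  apply: le_trans (ler_wpM2r (exprn_ge0 _ rho_ge0) (cmod_le_sum _ _ _)) _.
  rewrite mulr_suml; apply: ler_sum => q /eqP <-.
  by rewrite mindex_size_add exprD cmodM /t mulrACA.
rewrite /tnorm mulr_suml exchange_big /=; apply: ler_sum => p _.
rewrite mulr_sumr; under eq_bigr => k _ do rewrite big_mkcond /=.
rewrite exchange_big /=; apply: ler_sum => q _; rewrite -/(t p q).
rewrite -big_mkcond big_const_seq iter_addr_0 -[leRHS]mulr1n.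
apply: ler_wpMn2l => //.
rewrite (eq_count (a2 := pred1 (mindex_add p q))) => [|k]; last exact: eq_sym.
by rewrite count_uniq_mem ?leq_b1 ?mball_uniq.
Qed.

End TruncatedNorm.

(** * Norm bounds and analyticity *)

Section Analyticity.
Variables (R : realType) (nu : nat).
Implicit Types (m k p q : mindex nu) (n : degree nu) (f g : fps R nu).

(** Absolute convergence at the point (r/2, ..., r/2) of the polydisc. *)
Lemma fps_analytic_bound f : fps_analytic f ->
  exists2 r : R, 0 < r & exists S : R, forall (s : seq (mindex nu)), uniq s ->
    \sum_(m <- s) cmod (f m) * r ^+ mindex_size m <= S.
Proof.
move=> [r r0 fr]; exists (r / 2); first by rewrite divr_gt0.
have r20 : 0 <= r / 2 by rewrite divr_ge0 ?ltW.
have zr (i : 'I_nu) : cmod (r / 2)%:C%C < r.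
  by rewrite cmod_real // ltr_pdivrMr // ltr_pMr // ltr1n.
have := fr (fun=> (r / 2)%:C%C) zr; set E := (X in (X < _)%E) => Eoo.
exists (fine E) => s us; rewrite -lee_fin fineK; last first.
  rewrite ge0_fin_numE //; apply: esum_ge0 => m _; exact: cmod_ge0.
apply: esum_ge; exists [set` s]; first by split => //; exact: finite_seq.
rewrite -fsbig_seq // sumEFin lee_fin; apply: ler_sum => m _.
rewrite cmodM cmod_prod; apply: ler_wpM2l; first exact: cmod_ge0.
rewrite /mindex_size -prodrXr le_eqVlt; apply/orP; left; apply/eqP.
by apply: eq_bigr => j _; rewrite cmodX cmod_real.
Qed.

Lemma analytic_of_tnorm f (rho M : R) : 0 < rho ->
  (forall d, tnorm rho d f <= M) -> fps_analytic f.
Proof.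
move=> rho0 fM; exists rho => // z zrho; apply: (@le_lt_trans _ _ M%:E); last exact: ltry.
apply: ge_ereal_sup => _ [A [finA _] <-]; rewrite fsbig_finite // sumEFin lee_fin.
set s := finmap.enum_fset _; pose d := (\sum_(m <- s) mindex_size m)%N.
apply: le_trans (fM d); apply: le_trans (_ : _ <=
    \sum_(m <- s) cmod (f m) * rho ^+ mindex_size m) _.
  apply: ler_sum => m _; rewrite cmodM cmod_prod.
  apply: ler_wpM2l; first exact: cmod_ge0.
  rewrite /mindex_size -prodrXr; apply: ler_prod => j _.
  by rewrite cmodX exprn_ge0 ?cmod_ge0 // lerXn2r ?nnegrE ?cmod_ge0 // ltW.
apply: ler_sum_sub; [exact: finmap.fset_uniq|exact: mball_uniq| |].
  by move=> m ms; rewrite mem_mball /d (big_rem m) //= leq_addr.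
by move=> m; apply: tnorm_term_ge0; exact: ltW.
Qed.

End Analyticity.

(** * The fixed point estimate *)

Section MajorantEstimate.
Variables (R : realType) (nu : nat) (X : vfield R nu) (lam : 'I_nu -> R[i]).
Implicit Types (m k p q : mindex nu) (n : degree nu).
Variables (C S r rho : R).
Hypothesis X0 : forall i, X i [ffun=> 0%N] = 0.
Hypothesis C_gt0 : 0 < C.
Hypothesis Omega_ge : forall w, Omega X lam w -> C <= cmod w.
Hypothesis r_gt0 : 0 < r.
Hypothesis X_bound : forall i (s : seq (mindex nu)), uniq s ->
  \sum_(m <- s) cmod (X i m) * r ^+ mindex_size m <= S.
Hypothesis rho_gt0 : 0 < rho.
Hypothesis rho_le : 2 * rho <= r.
Hypothesis rho_small : 4 * rho * S <= C * r ^+ 2.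

Let a m k : R[i] := Na X lam (monomial R m) k.

Lemma Omega_neq0 w : Omega X lam w -> w != 0.
Proof.
by move=> /Omega_ge Cw; rewrite -cmod_eq0 gt_eqF // (lt_le_trans C_gt0).
Qed.

Lemma Na_monomial_at0 m : (0 < mindex_size m)%N -> a m [ffun=> 0%N] = 0.
Proof.
move=> m0; apply/eqP; apply: contraTT m0 => /(Na_monomial_size X0).
rewrite -leqNgt => h; apply: leq_trans h _.
by rewrite /mindex_size big1 // => j _; rewrite ffunE.
Qed.

Let a_mul m m' : a (mindex_add m m') = fps_mul (a m) (a m').
Proof. exact: Na_monomial_mul X0 Omega_neq0 _ _. Qed.

(** By multiplicativity Na x^m is a product of size-m many series Na x_i; with at
    least two factors, a bound up to degree d holds up to degree d + 1. *)
Lemma tnorm_Na_monomial d m :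
  (forall i, tnorm rho d (a (mindex1 i)) <= 2 * rho) -> (0 < mindex_size m)%N ->
  tnorm rho d (a m) <= (2 * rho) ^+ mindex_size m /\
  ((1 < mindex_size m)%N -> tnorm rho d.+1 (a m) <= (2 * rho) ^+ mindex_size m).
Proof.
move=> hd; have rho0 := ltW rho_gt0; have rho20 : 0 <= 2 * rho by rewrite mulr_ge0.
have [N] := ubnP (mindex_size m); elim: N m => // N IH m mN m0.
have [i mi] := mindex_size_gt0 m0; have [q mE qm] := mindex_add_subr mi.
rewrite qm; have [q0|q0] := posnP (mindex_size q).
  have qE : q = [ffun=> 0%N].
    apply/ffunP => j; rewrite ffunE.
    by move: q0; rewrite /mindex_size (bigD1 j) //=; lia.
  have -> : m = mindex1 i by rewrite mE qE; apply/ffunP => j; rewrite !ffunE addn0.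
  by rewrite q0 expr1; split.
have [|qd _] := IH q _ q0; first by rewrite -ltnS -qm.
have mulS : tnorm rho d.+1 (a m) <= (2 * rho) ^+ (mindex_size q).+1.
  rewrite {1}mE a_mul exprS; apply: le_trans (tnorm_mulS _ _ _ _) _ => //.
  - by apply: Na_monomial_at0; rewrite mindex_size1.
  - exact: Na_monomial_at0.
  - by apply: ler_pM => //; exact: tnorm_ge0.
by split => //; apply: le_trans mulS; exact: tnorm_leS.
Qed.

Lemma dcoef_mindex1_neq0 n i : dcoef X n (mindex1 i) != 0 ->
  (1 < mindex_size (mshift (mindex1 i) n))%N /\
  dcoef X n (mindex1 i) = X i (mshift (mindex1 i) n).
Proof.
move=> cn; have := dcoef_size X0 cn; rewrite mindex_size1 => m1; split => //.
move: cn; rewrite dcoef_mindex1 /vf_homog; case: ifP => _; last by rewrite eqxx.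
by rewrite /vf_sub /vf_lin gtn_eqF // subr0.
Qed.

(** D_n x_i is the monomial x^n x_i of X_i, so the sum is dominated by the
    majorant series at 2 rho of X_i without its linear part. As this series
    starts in degree 2, passing from r to 2 rho gains the factor (2 rho / r)^2. *)
Lemma dcoef_bound i (s : seq (degree nu)) : uniq s ->
  \sum_(n <- s) cmod (dcoef X n (mindex1 i)) *
     (2 * rho) ^+ mindex_size (mshift (mindex1 i) n) <= (2 * rho / r) ^+ 2 * S.
Proof.
move=> us; pose s' := [seq n <- s | dcoef X n (mindex1 i) != 0].
pose t := [seq mshift (mindex1 i) n | n <- s'].
have ut : uniq t.
  rewrite map_inj_in_uniq ?filter_uniq // => n n'; rewrite !mem_filter.
  move=> /andP[/dcoef_neq0[_ e] _] /andP[/dcoef_neq0[_ e'] _] nn'.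
  by apply/ffunP => j; apply: (addrI (mindex1 i j)%:Z); rewrite -e -e' nn'.
have rho0 := ltW rho_gt0; have r0 := ltW r_gt0.
apply: le_trans (ler_wpM2l _ (X_bound i ut)); last first.
  by rewrite exprn_ge0 // divr_ge0 ?mulr_ge0.
rewrite big_map big_filter mulr_sumr big_mkcond [leRHS]big_mkcond /=.
apply: ler_sum => n _; case: ifP => [cn|/negbFE/eqP->]; last by rewrite cmod0 mul0r.
have [m1 ->] := dcoef_mindex1_neq0 cn.
rewrite mulrCA; apply: ler_wpM2l; first exact: cmod_ge0.
move: (mindex_size _) m1 => [|[|l]] // _.
have -> : (2 * rho / r) ^+ 2 * r ^+ l.+2 = r ^+ l * (2 * rho) ^+ 2.
  by rewrite -[l.+2]addn2 exprD; field; rewrite gt_eqF.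
rewrite -[l.+2]addn2 exprD; apply: ler_wpM2r; first by rewrite exprn_ge0 ?mulr_ge0.
by rewrite lerXn2r ?nnegrE ?mulr_ge0.
Qed.

(** The coefficient of x_i in Na x_i is 1, which accounts for rho. For the other
    coefficients, the recursion and the lower bound C on the divisors give at
    most C^-1 sum_n |c_n| (2 rho)^|n + e_i|, where only products of at least two
    series Na x_j occur; this is again at most rho when rho is small. *)
Lemma tnorm_Na_var d i : tnorm rho d (a (mindex1 i)) <= 2 * rho.
Proof.
have rho0 := ltW rho_gt0.
elim: d i => [|d IH] i.
  rewrite /tnorm big_seq big1 ?mulr_ge0 // => k; rewrite mem_mball leqn0 => /eqP k0.
  rewrite [a _ _](_ : _ = 0) ?cmod0 ?mul0r //; apply/eqP.
  have : ~~ (1 <= mindex_size k)%N by rewrite k0.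
  by apply: contraNT => /(Na_monomial_size X0); rewrite mindex_size1.
pose c n := dcoef X n (mindex1 i); pose B := degball nu d.+1.
have coef_le k : (mindex_size k <= d.+1)%N -> k != mindex1 i ->
    cmod (a (mindex1 i) k) <=
    C^-1 * \sum_(n <- B) cmod (c n) * cmod (a (mshift (mindex1 i) n) k).
  move=> kd ki; have [->|ak] := eqVneq (a (mindex1 i) k) 0.
    rewrite cmod0 mulr_ge0 ?invr_ge0 ?(ltW C_gt0) // sumr_ge0 // => n _.
    by rewrite mulr_ge0 ?cmod_ge0.
  have [s [Xs sE s0]] := Na_monomial_word ak.
  have Cle : C <= cmod (weight lam k - weight lam (mindex1 i)).
    rewrite -sE; apply: Omega_ge; exists s; split; rewrite ?pairing_sum //.
    by move=> /s0 kE; rewrite kE eqxx in ki.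
  rewrite ler_pdivlMl //; apply: le_trans (ler_wpM2r (cmod_ge0 _) Cle) _.
  rewrite -cmodM (Na_monomial_rec X0 Omega_neq0 _ kd).
  by apply: le_trans (cmod_le_sum _ _ _) _; apply: ler_sum => n _; rewrite cmodM.
have -> : 2 * rho = rho + rho by ring.
rewrite /tnorm (bigD1_seq (mindex1 i)) ?mball_uniq ?mem_mball ?mindex_size1 //=.
rewrite [a _ (mindex1 i)]Na_monomial_diag // cmod1 mul1r expr1 lerD2l.
apply: (@le_trans _ _ (C^-1 * \sum_(n <- B) cmod (c n) *
    tnorm rho d.+1 (a (mshift (mindex1 i) n)))).
  (* Adding the term k = e_i on the right, the sum over k becomes a norm. *)
  rewrite big_mkcond /= /tnorm.
  under [X in _ <= _ * X]eq_bigr => n _ do rewrite mulr_sumr.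
  rewrite exchange_big mulr_sumr big_seq [leRHS]big_seq; apply: ler_sum => k.
  rewrite mem_mball => kd; case: ifPn => [ki|_]; last first.
    rewrite mulr_ge0 ?invr_ge0 ?(ltW C_gt0) // sumr_ge0 // => n _.
    by rewrite mulr_ge0 ?cmod_ge0 // tnorm_term_ge0.
  apply: le_trans (ler_wpM2r (exprn_ge0 _ rho0) (coef_le _ kd ki)) _.
  rewrite -mulrA mulr_suml; apply: ler_wpM2l; first by rewrite invr_ge0 ltW.
  by apply: ler_sum => n _; rewrite mulrA.
rewrite ler_pdivrMl //; apply: (@le_trans _ _ ((2 * rho / r) ^+ 2 * S)).
  apply: le_trans (dcoef_bound i (degball_uniq nu d.+1)).
  apply: ler_sum => n _; rewrite -/(c n).
  have [->|cn] := eqVneq (c n) 0; first by rewrite cmod0 !mul0r.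
  apply: ler_wpM2l; first exact: cmod_ge0.
  have [m1 _] := dcoef_mindex1_neq0 cn.
  by have [_] := tnorm_Na_monomial IH (ltnW m1); apply.
rewrite expr_div_n mulrAC ler_pdivrMr ?exprn_gt0 //.
have -> : (2 * rho) ^+ 2 * S = rho * (4 * rho * S) by ring.
have -> : C * rho * r ^+ 2 = rho * (C * r ^+ 2) by ring.
exact: ler_wpM2l.
Qed.

End MajorantEstimate.

Theorem mainTheorem10 (R : realType) (nu : nat) (X : vfield R nu)
    (lam : 'I_nu -> R[i])
    (X_analytic : local_analytic X)
    (X_diag : vf_lin X = diag_vf lam)
    (X_nosmall : no_small_divisors X lam)
    (lam_Poincare : Poincare_domain lam) :
  analytic_map (Na X lam).
Proof.
have X0 i : X i [ffun=> 0%N] = 0 by have [] := X_analytic i.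
have [C C0 OmegaC] := X_nosmall.
have /fin_all_exists2[r r0 /fin_all_exists[S XS]] i :=
  fps_analytic_bound (X_analytic i).1.
(* T is positive even if all S i vanish; the two terms in rho are the
   smallness conditions of the estimate, solved for rho. *)
pose r' := \big[Order.min/1]_i r i.
pose T := 1 + \sum_i S i.
have S0 i : 0 <= S i by have := XS i [::] isT; rewrite big_nil.
have T0 : 0 < T by rewrite ltr_pwDl // sumr_ge0.
have r'0 : 0 < r' by apply/bigmin_gtP.
have r'r i : r' <= r i by exact: bigmin_le.
pose rho := Order.min (r' / 2) (C * r' ^+ 2 / (4 * T)).
have rho0 : 0 < rho.
  by rewrite lt_min !divr_gt0 ?mulr_gt0 ?exprn_gt0.
move=> i; apply: (@analytic_of_tnorm _ _ _ rho (2 * rho)) => // d.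
apply: (@tnorm_Na_var _ _ X lam C T r' rho) => //.
- move=> j s us; apply: le_trans (_ : _ <= S j) _.
    apply: le_trans (XS j s us); apply: ler_sum => m _.
    apply: ler_wpM2l; first exact: cmod_ge0.
    by apply: lerXn2r; rewrite ?nnegrE ?r'r // ltW.
  by rewrite /T (bigD1 j) //= addrCA lerDl addr_ge0 // sumr_ge0.
- by rewrite mulrC -ler_pdivlMr // /rho ge_min lexx.
- by rewrite mulrAC mulrC -ler_pdivlMr ?mulr_gt0 // /rho ge_min lexx orbT.
Qed.
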